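(* Let $(X,\|\cdot\|)$ be a smooth and strictly convex Radon plane with unit circle $S$. Then, for any linearly independent vectors $x,y\in S$, $$\gamma(x,y)=\frac{\mathrm{cm}(x,x+y)}{\mathrm{cm}(y,x+y)},$$ where $\gamma$ is the outer distortion functional of the plane.
   Context: A Minkowski (normed) plane is a 2-dimensional real vector space $X$ with a norm $\|\cdot\|$; $o$ is the origin, $X_o=X\setminus\{o\}$, and $S$ is the unit circle. The plane is smooth if the unit ball has exactly one supporting line at each point of $S$, and strictly convex if $S$ contains no nondegenerate segment. Birkhoff orthogonality: $x\dashv_B y$ means $\|x+\lambda y\|\ge\|x\|$ for all $\lambda\in\mathbb{R}$. A Radon plane is a normed plane in which $\dashv_B$ is a symmetric relation. Fix a non-degenerate symplectic bilinear form $[\cdot,\cdot]$ on $X$ and define the antinorm $\|v\|_a=\sup\{|[v,w]|:w\in S\}$. In a smooth plane, for $x\in X_o$, $b(x)$ denotes the unique vector with $x\dashv_B b(x)$, $\|b(x)\|_a=1$ and $[x,b(x)]>0$. The cosine function is $\mathrm{cm}(x,y)=\dfrac{[y,b(x)]}{\|y\|}$ for $x,y\in X_o$ (it does not depend on the choice of the form). Outer distortion functional (smooth, strictly convex plane): for linearly independent $x,y\in S$, consider the angle (convex sector) formed by the rays from $o$ through $x$ and through $y$. Let $C$ be any circle of the norm inscribed in this angle (i.e. contained in the angle and tangent to both rays), touching the ray through $x$ at $\beta x$ and the ray through $y$ at $\alpha y$, $\alpha,\beta>0$. Then $\gamma(x,y)=\|\beta x\|/\|\alpha y\|=\beta/\alpha$,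 which does not depend on the choice of $C$. *)

(* Defs.v *)
From HB Require Import structures.
From mathcomp Require Import all_boot all_order all_algebra.
From mathcomp Require Import all_classical all_reals all_analysis.

Set Implicit Arguments.
Unset Strict Implicit.
Unset Printing Implicit Defensive.

Import Order.TTheory GRing.Theory Num.Theory.
Import numFieldNormedType.Exports.

Local Open Scope classical_set_scope.
Local Open Scope ring_scope.

(* Finite-dimensional normed spaces: the join of normed modules (which provide *)
(* the norm) and vector spaces (which provide \dim and free). Both share one   *)
(* module structure, so no compatibility axiom is needed.                      *)
#[short(type="normedVectType")]
HB.structure Definition NormedVector (R : numDomainType) :=
  {V of NormedModule R V & Vector R V}.

Section NormedPlane.
Context {R : realType} {X : normedVectType R}.
Implicit Types (x y v c p q d : X) (L : set X) (r : R).

Definition unit_circle : set X := [set x | `|x| = 1].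

Definition circle c r : set X := [set p | `|p - c| = r].

Definition line p d : set X := [set p + t *: d | t in [set: R]].

Definition is_line L := exists p d, d != 0 /\ L = line p d.

(* [ball c r] is the open ball. For 0 < r this says that L supports the closed *)
(* disc of center c and radius r at the point p of its boundary, i.e. that L   *)
(* is tangent to the circle at p.                                              *)
Definition supporting_line c r L p :=
  [/\ is_line L, L p, circle c r p & L `&` ball c r = set0].

Definition smooth := forall p, unit_circle p -> exists! L, supporting_line 0 1 L p.

Definition segment p q : set X :=
  [set (1 - t) *: p + t *: q | t in [set t : R | 0 <= t <= 1]].

Definition strictly_convex :=
  ~ exists p q, p != q /\ segment p q `<=` unit_circle.

Definition birkhoff x y := forall l : R, `|x| <= `|x + l *: y|.

Definition radon := forall x y, birkhoff x y -> birkhoff y x.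

Definition angle x y : set X :=
  [set u | exists s t : R, [/\ 0 <= s, 0 <= t & u = s *: x + t *: y]].

(* As the circle lies in the angle and p, q are required below to lie on the   *)
(* open rays, tangency to a ray is tangency to the line that it spans.         *)
Definition inscribed x y c r p q :=
  [/\ 0 < r, circle c r `<=` angle x y,
      supporting_line c r (line 0 x) p & supporting_line c r (line 0 y) q].

(* The ratio does not depend on the inscribed circle chosen, so that [get]     *)
(* denotes its common value.                                                   *)
Definition outer_distortion x y : R :=
  get [set g : R | exists c r alpha beta,
    [/\ 0 < alpha, 0 < beta, inscribed x y c r (beta *: x) (alpha *: y)
      & g = `|beta *: x| / `|alpha *: y| ]].

Section Form.
Variable form : {skew_symmetric X}.

Definition antinorm v : R := sup [set `|form v w| | w in unit_circle].

(* The vector b(x), which is unique in a smooth plane when x != 0.             *)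
Definition birkhoff_normal x : X :=
  get [set z | [/\ birkhoff x z, antinorm z = 1 & 0 < form x z]].

Definition cm x y : R := form y (birkhoff_normal x) / `|y|.

End Form.
End NormedPlane.

Arguments smooth {R} X.
Arguments strictly_convex {R} X.
Arguments radon {R} X.

(* Main.v *)
(** In a Radon plane the norm and the antinorm have the same support directions,
    hence a constant ratio. Therefore all the vectors [b x], where [b] is the
    Birkhoff normal and [x] a unit vector, have the same norm. The foot of a
    point [c] on the line of [x] is [form c (b x) *: x], at distance
    [`|form x c| * `|b x|] from [c]. The center of a circle inscribed in the
    angle of [x] and [y] is equidistant from both sides, hence it is
    [s *: (x + y)] for some [s > 0], and the points of contact are
    [s * form (x + y) (b x) *: x] and [s * form (x + y) (b y) *: y]. *)
Require Import Defs.
From mathcomp Require Import all_boot all_order all_algebra.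
From mathcomp Require Import all_classical all_reals all_analysis.
From mathcomp Require Import ring lra.

Set Implicit Arguments.
Unset Strict Implicit.
Unset Printing Implicit Defensive.

Import Order.TTheory GRing.Theory Num.Theory.
Import numFieldNormedType.Exports.
Local Open Scope classical_set_scope.
Local Open Scope ring_scope.

(** * Comparison of two functions with proportional support lines *)

Section CommonSupportLines.
Context {R : realType} (N F nu : R -> R) (m M : R).
Context (m_gt0 : 0 < m)
  (N_ge : forall t : R, 0 <= t <= 1 -> m <= N t)
  (F_bounded : forall t : R, 0 <= t <= 1 -> 0 <= F t <= M)
  (N_support : forall s t : R, 0 <= s <= 1 -> 0 <= t <= 1 ->
    N s + nu s * (t - s) <= N t)
  (F_support : forall s t : R, 0 <= s <= 1 -> 0 <= t <= 1 ->
    F s + F s / N s * nu s * (t - s) <= F t).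

(** Adding the support inequalities of [N] at [s] and at [t] makes [nu] monotone. The support line
    of [F] at [s] is [k = F s / N s] times that of [N], which falls short of [N t] by at most
    [(nu t - nu s) * (t - s)]. After division by [N t], the factor [k / N t] is at most
    [M / m ^+ 2]. *)
Let ratio_step (s t : R) : 0 <= s <= 1 -> 0 <= t <= 1 -> s <= t ->
  nu s * (t - s) <= nu t * (t - s) /\
  F s / N s - M / m ^+ 2 * (nu t - nu s) * (t - s) <= F t / N t.
Proof.
move=> s01 t01 st.
have Ns := N_support s01 t01; have Nt := N_support t01 s01.
have Fs := F_support s01 t01.
have mNs := N_ge s01; have mNt := N_ge t01.
have /andP[F0 FM] := F_bounded s01.
have Ns0 : 0 < N s by exact: lt_le_trans mNs.
have Nt0 : 0 < N t by exact: lt_le_trans mNt.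
have mon : nu s * (t - s) <= nu t * (t - s) by lra.
split => //.
rewrite ler_pdivlMr //.
set k := F s / N s in Fs *.
have Fk : F s = k * N s by rewrite /k mulfVK // gt_eqF.
have k0 : 0 <= k by rewrite /k divr_ge0 // ltW.
have kM : k <= M / m.
  rewrite /k ler_pdivrMr // (le_trans FM) // mulrAC ler_pdivlMr //.
  by rewrite ler_wpM2l // (le_trans F0).
have D0 : 0 <= (nu t - nu s) * (t - s) by lra.
have CD : k * ((nu t - nu s) * (t - s)) <=
    M / m ^+ 2 * ((nu t - nu s) * (t - s)) * N t.
  rewrite [leRHS]mulrAC ler_wpM2r // expr2 invfM mulrA.
  apply: le_trans (kM) _; rewrite mulrAC ler_pdivlMr //.
  rewrite ler_wpM2l // (le_trans k0 kM) //.
have : k * N t <= k * (N s + nu t * (t - s)) by rewrite ler_wpM2l //; lra.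
rewrite Fk in Fs; lra.
Qed.

Let ratio_grid (n i : nat) : (i <= n)%N ->
  F 0 / N 0 - M / m ^+ 2 * (nu (i%:R / n%:R) - nu 0) / n%:R
    <= F (i%:R / n%:R) / N (i%:R / n%:R).
Proof.
elim: i => [_|i IH lt_in]; first by rewrite mul0r subrr mulr0 mul0r subr0.
have n0 : 0 < n%:R :> R by rewrite ltr0n (leq_ltn_trans _ lt_in).
have grid01 (j : nat) : (j <= n)%N -> 0 <= (j%:R : R) / n%:R <= 1.
  by move=> jn; rewrite divr_ge0 //= ler_pdivrMr // mul1r ler_nat.
have st : i.+1%:R / n%:R - i%:R / n%:R = n%:R^-1 :> R.
  by rewrite -mulrBl -natr1 addrAC subrr add0r mul1r.
have ist : i%:R / n%:R <= i.+1%:R / n%:R :> R.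
  by rewrite -subr_ge0 st invr_ge0 ltW.
have [_] := ratio_step (grid01 _ (ltnW lt_in)) (grid01 _ lt_in) ist.
rewrite st; have := IH (ltnW lt_in); lra.
Qed.

(* Monotonicity of the slope [nu] makes the increment of [F / N] over a step of
   length [1 / n] at least [- C / n] times the increment of [nu], and these
   errors telescope; so neither [N] nor [F] has to be differentiated. *)
Lemma le_ratio_common_support : F 0 / N 0 <= F 1 / N 1.
Proof.
rewrite leNgt; apply/negP => lt10.
set d := F 0 / N 0 - F 1 / N 1; have d0 : 0 < d by rewrite /d subr_gt0.
set C := M / m ^+ 2 * (nu 1 - nu 0).
have [n nP] : exists n : nat, C / d < n%:R.
  by exists (Num.truncn (C / d)).+1; exact: truncnS_gt.
have n1 : 0 < n.+1%:R :> R by rewrite ltr0n.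
have := ratio_grid (leqnn n.+1).
rewrite divff ?gt_eqF // -/C.
suff : C / n.+1%:R < d by rewrite /d; move: (C / _) => e; lra.
rewrite ltr_pdivrMr // mulrC -ltr_pdivrMr //.
by rewrite (lt_le_trans nP) // ler_nat.
Qed.

End CommonSupportLines.

(** * Birkhoff orthogonality and supporting lines *)

Section Birkhoff.
Context {R : realType} {X : normedVectType R}.
Implicit Types (x y z c p q d : X) (r : R).

Lemma birkhoffZl (a : R) x y : birkhoff x y -> birkhoff (a *: x) y.
Proof.
move=> xy l; have [->|a0] := eqVneq a 0; first by rewrite scale0r normr0.
have -> : a *: x + l *: y = a *: (x + (l / a) *: y).
  by rewrite scalerDr scalerA mulrC mulfVK.
by rewrite !normrZ ler_wpM2l.
Qed.

Lemma birkhoffZr (a : R) x y : birkhoff x y -> birkhoff x (a *: y).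
Proof. by move=> xy l; rewrite scalerA. Qed.

Lemma birkhoff_le (a b : R) x y :
  birkhoff x y -> `|a| * `|x| <= `|a *: x + b *: y|.
Proof. by move=> /(@birkhoffZl a) /(_ b); rewrite normrZ. Qed.

(** A point of the line closer to [c] than [r] would lie in the open ball, so [p] is a nearest point
    of the line to [c]. *)
Lemma supporting_birkhoff c r q d p :
  supporting_line c r (line q d) p -> birkhoff (p - c) d.
Proof.
move=> [_ [t _ <-] cp /seteqP[disj _] l]; rewrite cp leNgt; apply/negP => lt_r.
suff [] : set0 (q + (t + l) *: d) by [].
apply: disj; split; first by exists (t + l).
rewrite -ball_normE /ball_ /= distrC.
by rewrite scalerDl addrA [_ - c]addrAC.
Qed.

Lemma birkhoff_supporting c r q d p :
  d != 0 -> line q d p -> `|p - c| = r -> birkhoff (p - c) d ->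
  supporting_line c r (line q d) p.
Proof.
move=> d0 Lp cp pd; split=> //; first by exists q, d.
case: Lp => t _ tp; apply/seteqP; split=> // _ [[s _ <-]].
rewrite -ball_normE /ball_ /= distrC ltNge => /negP; apply.
rewrite -cp; have := pd (s - t); congr (_ <= `|_|).
by rewrite -tp scalerBl addrAC -[q + _ + _]addrA [t *: d + _]addrC subrK.
Qed.

Lemma exists_birkhoff x :
  smooth X -> unit_circle x -> exists2 z, z != 0 & birkhoff x z.
Proof.
move=> smoothX /smoothX[L [[[p [d [d0 ->]]] Lx cx xL] _]].
exists d => //; rewrite -[x]subr0; apply: (@supporting_birkhoff 0 1 p).
by split=> //; exists p, d.
Qed.

(** Both directions span the unique supporting line at [x], so [x + z] lies on [line x w]. *)
Lemma birkhoff_uniq x z w : smooth X -> unit_circle x -> z != 0 -> w != 0 ->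
  birkhoff x z -> birkhoff x w -> exists k : R, z = k *: w.
Proof.
move=> smoothX Sx z0 w0 xz xw; have [L [_ Lu]] := smoothX x Sx.
have line_x d : line x d x by exists 0 => //; rewrite scale0r addr0.
have sL d : d != 0 -> birkhoff x d -> L = line x d.
  by move=> d0 xd; apply: Lu; apply: birkhoff_supporting => //; rewrite subr0.
have : line x w (x + z).
  by rewrite -(sL w w0 xw) (sL z z0 xz); exists 1 => //; rewrite scale1r.
by case=> k _ /addrI <-; exists k.
Qed.

End Birkhoff.

(** * Coordinates and antinorm from the symplectic form *)

Section SymplecticPlane.
Context {R : realType} {X : normedVectType R} (form : {skew_symmetric X}).
Implicit Types u v w x y z c : X.

Lemma skewC u v : form u v = - form v u.
Proof. by rewrite hermC expr1 mulN1r. Qed.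

Lemma skewvv v : form v v = 0.
Proof. by have := skewC v v; lra. Qed.

Lemma skew_combl (a b : R) u v w :
  form (a *: u + b *: v) w = a * form u w + b * form v w.
Proof. by rewrite linearDl /= !linearZl_LR. Qed.

Lemma skew_combr (a b : R) u v w :
  form w (a *: u + b *: v) = a * form w u + b * form w v.
Proof. by rewrite ![form w _]skewC skew_combl; ring. Qed.

Lemma skewZl (a : R) u w : form (a *: u) w = a * form u w.
Proof. by rewrite linearZl_LR. Qed.

Lemma skewZr (a : R) u w : form w (a *: u) = a * form w u.
Proof. by rewrite ![form w _]skewC skewZl mulrN. Qed.

Lemma skewDl u v w : form (u + v) w = form u w + form v w.
Proof. by rewrite -[u]scale1r -[v]scale1r skew_combl !scale1r !mul1r. Qed.

Lemma skewDr u v w : form w (u + v) = form w u + form w v.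
Proof. by rewrite ![form w _]skewC skewDl opprD. Qed.

Lemma skewNr u w : form w (- u) = - form w u.
Proof. by rewrite -[- u]scaleN1r skewZr mulN1r. Qed.

Lemma form_neq0_free u v : form u v != 0 -> free [:: u; v].
Proof.
move=> uv; rewrite free_cons seq1_free span_seq1; apply/andP; split.
  by apply: contra uv => /vlineP[k ->]; rewrite skewZl skewvv mulr0.
by apply: contra uv => /eqP->; rewrite -(scale0r v) skewZr mul0r.
Qed.

Context (dimX : \dim {: X} = 2%N) (sympl : is_psymplectic form).

Lemma free_span_plane u v w : free [:: u; v] ->
  exists ab : R * R, w = ab.1 *: u + ab.2 *: v.
Proof.
move=> uv; have := memvf w.
have -> : fullv = <<[:: u; v]>>%VS :> {vspace X}.
  apply/esym/eqP; rewrite eqEdim subvf dimX.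
  by move: uv; rewrite /free => /eqP->.
rewrite span_cons span_seq1 => /memv_addP[_ /vlineP[a ->] [_ /vlineP[b ->] ->]].
by exists (a, b).
Qed.

(** Otherwise [u] would pair to zero with the span of [u] and [v], which is the whole plane, against
    nondegeneracy. *)
Lemma free_form_neq0 u v : free [:: u; v] -> form u v != 0.
Proof.
move=> uv; apply/negP => /eqP uv0; have [/eqP rad0 _ _] := sympl.
have : u \in (0%VS : {vspace X}).
  rewrite -rad0; apply/mem_orthovP => w _.
  have [[a b] /= ->] := free_span_plane w uv.
  by rewrite skew_combr skewvv uv0; ring.
rewrite memv0 => /eqP u0; move: uv.
by rewrite free_cons u0 mem0v.
Qed.

(** Cramer's rule in the basis [u], [v]. *)
Lemma form_decomp u v w : form u v != 0 ->
  w = (form w v / form u v) *: u + (form u w / form u v) *: v.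
Proof.
move=> uv; have [[a b] /= ->] := free_span_plane w (form_neq0_free uv).
rewrite skew_combl skew_combr !skewvv !mulr0 addr0 add0r.
by rewrite !mulfK.
Qed.

(** Dropping the [v] component of [w] does not increase the norm. Thus pairing with [v] is, relative
    to the norm, largest in the direction of [u], which is what computes the antinorm of [v]. *)
Lemma birkhoff_form_le u v w : form u v != 0 -> birkhoff u v ->
  `|form w v| * `|u| <= `|form u v| * `|w|.
Proof.
move=> uv0 uv.
have := birkhoff_le (form w v / form u v) (form u w / form u v) uv.
rewrite -form_decomp // normrM normfV mulrAC ler_pdivrMr ?normr_gt0 //.
by rewrite [_ * `|w|]mulrC.
Qed.

Lemma birkhoff_form_neq0 u v : u != 0 -> v != 0 -> birkhoff u v ->
  form u v != 0.
Proof.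
move=> u0 v0 uv; apply: free_form_neq0.
rewrite free_cons seq1_free v0 span_seq1 andbT; apply/negP => /vlineP[k uk].
(* If [u = k *: v], the shift by [- k *: v] reaches the origin. *)
have := uv (- k); rewrite scaleNr {2}uk subrr normr0 normr_le0.
exact/negP.
Qed.

Lemma antinorm_birkhoff x z : unit_circle x -> form x z != 0 -> birkhoff x z ->
  antinorm form z = `|form x z|.
Proof.
move=> Sx xz0 xz.
have ub : ubound [set `|form z w| | w in unit_circle] `|form x z|.
  move=> _ [w Sw <-]; have := birkhoff_form_le w xz0 xz.
  by rewrite Sx Sw !mulr1 skewC normrN.
have memx : [set `|form z w| | w in unit_circle] `|form x z|.
  by exists x => //; rewrite skewC normrN.
apply/le_anti/andP; split; first by apply: ge_sup => //; eexists; exact: memx.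
by apply: ub_le_sup => //; exists `|form x z|.
Qed.

Context (smoothX : smooth X) (radonX : radon X).

Lemma unit_circle_neq0 x : unit_circle x -> x != 0.
Proof. by move=> Sx; rewrite -normr_eq0 Sx oner_eq0. Qed.

Lemma exists_unit_normal v : v != 0 ->
  exists u, [/\ unit_circle u, birkhoff v u, birkhoff u v & 0 < form v u].
Proof.
move=> v0; have nv0 : `|v| != 0 by rewrite normr_eq0.
have unitZ w : w != 0 -> unit_circle (`|w|^-1 *: w).
  by move=> w0; rewrite /unit_circle /= normrZ normfV normr_id mulVf //
    normr_eq0.
have [z z0 vz] := exists_birkhoff smoothX (unitZ v v0).
have {}vz : birkhoff v z.
  by have := birkhoffZl `|v| vz; rewrite scalerA mulfV // scale1r.
have f0 := birkhoff_form_neq0 v0 z0 vz.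
(* The sign orients [z] and the other factor normalizes it. *)
set k := Num.sg (form v z) * `|z|^-1.
exists (k *: z); split.
- rewrite /unit_circle /= normrZ normrM normr_sg f0 mul1r normfV normr_id.
  by rewrite mulVf // normr_eq0.
- exact: birkhoffZr.
- exact/radonX/birkhoffZr.
- by rewrite skewZr /k mulrAC -normrEsg divr_gt0 // normr_gt0.
Qed.

(** Since [beta v] is Birkhoff orthogonal to [v], it maximizes the pairing with [v] over the unit
    circle, so [F v] is the antinorm of [v]. Along the segment from [x] to [y] the norm and [F] have
    proportional support lines, hence [F x <= F y], the endpoints having norm 1. *)
Lemma radon_unit_normal_le x y u w :
  unit_circle x -> unit_circle y -> unit_circle u -> unit_circle w ->
  birkhoff u x -> birkhoff w y -> form x y != 0 ->
  `|form x u| <= `|form y w|.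
Proof.
move=> Sx Sy Su Sw ux wy xy0.
have /choice[beta betaP] : forall v, exists b, v != 0 ->
    [/\ unit_circle b, birkhoff v b, birkhoff b v & 0 < form v b].
  move=> v; have [->|v0] := eqVneq v 0; first by exists 0.
  by have [b bP] := exists_unit_normal v0; exists b.
pose F v := form v (beta v).
have F_gt0 v : v != 0 -> 0 < F v by move=> /betaP[].
have form_le v b : v != 0 -> unit_circle b -> birkhoff b v ->
    forall a, `|form v a| <= `|form v b| * `|a|.
  move=> v0 Sb bv a.
  have bv0 := birkhoff_form_neq0 (unit_circle_neq0 Sb) v0 bv.
  have := birkhoff_form_le a bv0 bv.
  by rewrite Sb mulr1 skewC normrN [form b v]skewC normrN.
have F_le v a : v != 0 -> `|form v a| <= F v * `|a|.
  move=> v0; have [Sb _ bv F0] := betaP v v0.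
  by apply: le_trans (form_le _ _ v0 Sb bv a) _; rewrite gtr0_norm.
have [x0 y0] := (unit_circle_neq0 Sx, unit_circle_neq0 Sy).
apply: (@le_trans _ _ (F x)).
  by have := F_le x u x0; rewrite Su mulr1.
apply: (@le_trans _ _ (F y)); last first.
  have [Sb _ _ F0] := betaP y y0.
  have := form_le y w y0 Sw wy (beta y).
  by rewrite Sb mulr1 gtr0_norm.
(* The pairing of [p t] with [d] is constantly [form x y], so the segment avoids the origin. *)
pose d := y - x; pose p t := x + t *: d.
have p_dist s t : p t = p s + (t - s) *: d.
  by rewrite /p -addrA -scalerDl addrC [s + _]addrC subrK addrC.
have formxd : form x d = form x y.
  by rewrite /d -[y]scale1r -scaleN1r skew_combr skewvv scale1r; ring.
have form_pd t : form (p t) d = form x y.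
  by rewrite /p skewDl skewZl skewvv formxd; ring.
have d0 : d != 0.
  by apply: contra xy0 => /eqP d0; rewrite -formxd d0 -(scale0r d) skewZr mul0r.
have p0 t : p t != 0.
  apply: contra xy0 => /eqP pt0; rewrite -(form_pd t) pt0.
  by rewrite -(scale0r d) skewZl mul0r.
have form_p s t a : form (p t) a = form (p s) a + (t - s) * form d a.
  by rewrite (p_dist s t) skewDl skewZl.
(* The slope of the norm at [p s] is that of the line of direction
   [beta (p s)] through [p s], which also supports the antinorm ball. *)
have := @le_ratio_common_support _ (fun t => `|p t|) (fun t => F (p t))
  (fun t => `|p t| * form d (beta (p t)) / F (p t))
  (`|form x y| / F d) (F x + F y).
have -> : p 0 = x by rewrite /p scale0r addr0.
have -> : p 1 = y by rewrite /p scale1r /d addrC subrK.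
rewrite Sx Sy !divr1; apply.
- by rewrite divr_gt0 ?normr_gt0 ?F_gt0.
(* This constant pairing is at most [F d] times the norm of [p t]. *)
- move=> t _; rewrite ler_pdivrMr ?F_gt0 // mulrC -(form_pd t) skewC normrN.
  exact: F_le.
(* [F (p t)] is a convex combination of pairings of [x] and [y] with one unit vector. *)
- move=> t /andP[t0 t1]; rewrite ltW ?F_gt0 //=.
  have [Sb _ _ _] := betaP _ (p0 t).
  have Fxb := F_le x (beta (p t)) x0; have Fyb := F_le y (beta (p t)) y0.
  rewrite Sb !mulr1 in Fxb Fyb.
  have {}Fxb := le_trans (ler_norm _) Fxb.
  have {}Fyb := le_trans (ler_norm _) Fyb.
  have pt : p t = (1 - t) *: x + t *: y.
    by rewrite /p /d scalerBr scalerBl scale1r addrCA addrC.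
  rewrite /F {1}pt skew_combl.
  have := F_gt0 x x0; have := F_gt0 y y0; rewrite /F in Fxb Fyb *.
  nra.
(* Multiplied by [F (p s)], the support line becomes the norm of [p s] times
   [form (p t) (beta (p s))]. *)
- move=> s t _ _; have [Sb pb bp F0] := betaP _ (p0 s).
  have := birkhoff_form_le (p t) (lt0r_neq0 F0) pb.
  rewrite (gtr0_norm F0) => le1.
  have {}le1 := le_trans (ler_wpM2r (normr_ge0 _) (ler_norm _)) le1.
  rewrite -(ler_pM2l F0); apply: le_trans le1.
  rewrite (form_p s t) -/(F (p s)) le_eqVlt; apply/orP; left; apply/eqP.
  by field; apply: lt0r_neq0 (F_gt0 _ (p0 s)).
(* Here the support line is exactly [form (p t) (beta (p s))], which the antinorm of [p t]
   dominates. *)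
- move=> s t _ _; have [Sb pb bp F0] := betaP _ (p0 s).
  have := le_trans (ler_norm _) (F_le (p t) (beta (p s)) (p0 t)).
  rewrite Sb mulr1; apply: le_trans.
  rewrite (form_p s t) -/(F (p s)) le_eqVlt; apply/orP; left; apply/eqP.
  by field; rewrite normr_eq0 p0 (lt0r_neq0 (F_gt0 _ (p0 s))).
Qed.

End SymplecticPlane.

(** * Birkhoff normals and inscribed circles in a Radon plane *)

Section RadonPlane.
Context {R : realType} {X : normedVectType R} (form : {skew_symmetric X}).
Context (dimX : \dim {: X} = 2%N) (sympl : is_psymplectic form).
Context (smoothX : smooth X) (radonX : radon X).
Implicit Types u v w x y z c : X.

Let b := @birkhoff_normal R X form.

(** By [antinorm_birkhoff], normalizing the antinorm amounts to [form x (b x) = 1]; a rescaled unit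
    normal shows that [get] has a witness. *)
Lemma birkhoff_normalP x : unit_circle x ->
  birkhoff x (b x) /\ form x (b x) = 1.
Proof.
move=> Sx.
have [xb ab fb] : [/\ birkhoff x (b x), antinorm form (b x) = 1
    & 0 < form x (b x)].
  apply: (@getPex X
    [set z | [/\ birkhoff x z, antinorm form z = 1 & 0 < form x z]]).
  have [u [Su xu _ fu]] := exists_unit_normal dimX sympl smoothX radonX
    (unit_circle_neq0 Sx).
  have f1 : form x ((form x u)^-1 *: u) = 1.
    by rewrite skewZr mulVf // lt0r_neq0.
  exists ((form x u)^-1 *: u); split; rewrite ?f1 //; first exact: birkhoffZr.
  rewrite (antinorm_birkhoff dimX Sx) ?f1 ?normr1 ?oner_eq0 //.
  exact: birkhoffZr.
split=> //; rewrite -ab (antinorm_birkhoff dimX Sx) ?gtr0_norm //.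
exact: lt0r_neq0.
Qed.

Lemma birkhoff_normal_neq0 x : unit_circle x -> b x != 0.
Proof.
move=> /birkhoff_normalP[_ f1]; apply/negP => /eqP b0.
by move: f1; rewrite b0 -(scale0r x) skewZr mul0r => /esym/eqP;
  rewrite oner_eq0.
Qed.

(** The normalized [b v] pairs with [v] to the inverse of the norm of [b v], so the comparison of
    unit normals applies in both orders. *)
Lemma norm_birkhoff_normal_eq x y : unit_circle x -> unit_circle y ->
  form x y != 0 -> `|b x| = `|b y|.
Proof.
suff le x' y' : unit_circle x' -> unit_circle y' -> form x' y' != 0 ->
    `|b y'| <= `|b x'|.
  by move=> Sx Sy xy0; apply/le_anti/andP; split; apply: le => //;
    rewrite skewC oppr_eq0.
move=> Sx Sy xy0.
have nb v : unit_circle v -> 0 < `|b v|.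
  by move=> Sv; rewrite normr_gt0 birkhoff_normal_neq0.
have fb v : unit_circle v -> `|form v (`|b v|^-1 *: b v)| = `|b v|^-1.
  by move=> Sv; rewrite skewZr (birkhoff_normalP Sv).2 mulr1 normfV normr_id.
have Sb v : unit_circle v -> unit_circle (`|b v|^-1 *: b v).
  move=> Sv; rewrite /unit_circle /= normrZ normfV normr_id mulVf //.
  exact: lt0r_neq0 (nb v Sv).
have bv v : unit_circle v -> birkhoff (`|b v|^-1 *: b v) v.
  by move=> Sv; apply/birkhoffZl/radonX; have [] := birkhoff_normalP Sv.
have := radon_unit_normal_le dimX sympl smoothX radonX Sx Sy (Sb _ Sx) (Sb _ Sy)
  (bv _ Sx) (bv _ Sy) xy0.
by rewrite !fb // lef_pV2 ?posrE ?nb.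
Qed.

Lemma birkhoff_normal_decomp x c : unit_circle x ->
  c = form c (b x) *: x + form x c *: b x.
Proof.
move=> /birkhoff_normalP[_ f1].
have f0 : form x (b x) != 0 by rewrite f1 oner_eq0.
by have := form_decomp dimX c f0; rewrite f1 !divr1.
Qed.

Lemma form_birkhoff_normal_le1 x y : unit_circle x -> unit_circle y ->
  `|form y (b x)| <= 1.
Proof.
move=> Sx Sy; have [xb f1] := birkhoff_normalP Sx.
have f0 : form x (b x) != 0 by rewrite f1 oner_eq0.
by have := birkhoff_form_le dimX y f0 xb; rewrite f1 Sx Sy !mulr1 normr1.
Qed.

(** The value is [1 + form y (b x)], which is nonnegative. If it were zero, [y] would lie on the
    line through [- x] of direction [b x]. The segment from [- x] to [y] would then have norm at
    least 1 by orthogonality and at most 1 by convexity, against strict convexity. *)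
Lemma form_add_birkhoff_normal_gt0 x y : strictly_convex X ->
  unit_circle x -> unit_circle y -> form x y != 0 -> 0 < form (x + y) (b x).
Proof.
move=> scX Sx Sy xy0; have [xb f1] := birkhoff_normalP Sx.
have := form_birkhoff_normal_le1 Sx Sy; rewrite ler_norml => /andP[le1 _].
rewrite skewDl f1 -(opprK 1) addrC subr_gt0 lt_neqAle le1 andbT.
apply/negP => /eqP fyb; apply: scX; exists (- x), y.
have yE : y = - x + form x y *: b x.
  by rewrite {1}(birkhoff_normal_decomp y Sx) -fyb scaleN1r.
split.
  apply: contra xy0 => /eqP <-.
  by rewrite -scaleN1r skewZr skewvv mulr0.
move=> _ [t /= /andP[t0 t1] <-]; apply/le_anti/andP; split.
  apply: le_trans (ler_normD _ _) _; rewrite !normrZ normrN Sx Sy !mulr1.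
  by rewrite !ger0_norm ?subr_ge0 // subrK.
have -> : (1 - t) *: - x + t *: y = (-1) *: x + (t * form x y) *: b x.
  rewrite {1}yE scalerDr scalerA addrA -scalerDl subrK scale1r.
  by rewrite scaleN1r.
by have := birkhoff_le (-1) (t * form x y) xb; rewrite normrN1 Sx mulr1.
Qed.

(** Symmetry turns tangency into [x] being orthogonal to the radius, and smoothness makes the radius
    a multiple of [b x]. Pairing with [b x] and with [x] then gives both values. *)
Lemma supporting_foot x c (r beta : R) : unit_circle x -> 0 < r ->
  supporting_line c r (line 0 x) (beta *: x) ->
  beta = form c (b x) /\ r = `|form x c| * `|b x|.
Proof.
move=> Sx r0 sup; have [xb f1] := birkhoff_normalP Sx.
have xp := radonX (supporting_birkhoff sup).
have [_ _ cp _] := sup; rewrite /circle /= in cp.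
have p0 : beta *: x - c != 0 by rewrite -normr_eq0 cp gt_eqF.
have [k kE] := birkhoff_uniq smoothX Sx p0 (birkhoff_normal_neq0 Sx) xp xb.
have cE : c = beta *: x + (- k) *: b x by rewrite scaleNr -kE opprB addrC subrK.
rewrite [in form c _]cE [in form x c]cE skew_combl skew_combr f1 !skewvv.
split; first by ring.
by rewrite -cp kE normrZ !mulr0 add0r mulr1 normrN.
Qed.

Lemma foot_supporting x c : unit_circle x ->
  supporting_line c (`|form x c| * `|b x|) (line 0 x) (form c (b x) *: x).
Proof.
move=> Sx; have [xb f1] := birkhoff_normalP Sx.
have pE : form c (b x) *: x - c = (- form x c) *: b x.
  rewrite {2}(birkhoff_normal_decomp c Sx) opprD addrA subrr add0r.
  by rewrite scaleNr.
apply: birkhoff_supporting.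
- exact: unit_circle_neq0.
- by exists (form c (b x)) => //; rewrite add0r.
- by rewrite pE normrZ normrN.
- by rewrite pE; apply/birkhoffZl/radonX.
Qed.

(** The center is the midpoint of two antipodal points of the circle, and the angle is convex. *)
Lemma circle_subset_angle_center x y c (r : R) : x != 0 -> 0 < r ->
  circle c r `<=` angle x y -> angle x y c.
Proof.
move=> x0 r0 sub; have nx : 0 < `|x| by rewrite normr_gt0.
have onc (e : R) : `|e| = r -> circle c r (c + (e / `|x|) *: x).
  move=> er; rewrite /circle /= addrC addKr normrZ normrM normfV normr_id.
  by rewrite mulfVK // lt0r_neq0.
have [s1 [t1 [s10 t10 e1]]] := sub _ (onc r (gtr0_norm r0)).
have [|s2 [t2 [s20 t20 e2]]] := sub _ (onc (- r) _).
  by rewrite normrN gtr0_norm.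
exists ((s1 + s2) / 2), ((t1 + t2) / 2); split; rewrite ?divr_ge0 ?addr_ge0 //.
have : c + c = (s1 + s2) *: x + (t1 + t2) *: y.
  rewrite !scalerDl addrACA -e1 -e2 mulNr scaleNr addrACA subrr addr0 //.
rewrite -mulr2n -scaler_nat => /(congr1 ( *:%R 2^-1)).
by rewrite scalerA mulVf ?pnatr_eq0 // scale1r scalerDr !scalerA
  ![2^-1 * _]mulrC.
Qed.

Lemma inscribed_center x y c (r alpha beta : R) :
  unit_circle x -> unit_circle y -> form x y != 0 ->
  inscribed x y c r (beta *: x) (alpha *: y) ->
  exists2 s : R, s != 0 &
    beta = s * form (x + y) (b x) /\ alpha = s * form (x + y) (b y).
Proof.
move=> Sx Sy xy0 [r0 sub supx supy].
have [s [t [s0 t0 cE]]] := circle_subset_angle_center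
  (unit_circle_neq0 Sx) r0 sub.
have [betaE rx] := supporting_foot Sx r0 supx.
have [alphaE ry] := supporting_foot Sy r0 supy.
(* Equal distances give equal absolute values of the coordinates; their signs are known because the
   center lies in the angle. *)
have st : s = t.
  move: ry; rewrite rx (norm_birkhoff_normal_eq Sx Sy xy0) cE !skew_combr.
  rewrite !skewvv.
  rewrite [form y x]skewC !mulr0 add0r addr0 mulrN normrN !normrM.
  rewrite (ger0_norm s0) (ger0_norm t0).
  move=> /mulIf; rewrite normr_eq0 birkhoff_normal_neq0 // => /(_ isT).
  by move=> /mulIf; rewrite normr_eq0 => /(_ xy0).
have {}cE : c = s *: (x + y) by rewrite cE -st scalerDr.
exists s; last by rewrite betaE alphaE cE !skewZl.
apply: contraTneq r0 => s00; rewrite rx cE s00 skewZr mul0r normr0 mul0r.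
by rewrite ltxx.
Qed.

(** This exhibits one inscribed circle. Its center has both coordinates 1, and on the circle each
    coordinate differs from 1 by at most 1, hence stays nonnegative. *)
Lemma inscribed_add x y : strictly_convex X ->
  unit_circle x -> unit_circle y -> form x y != 0 ->
  inscribed x y (x + y) (`|form x y| * `|b x|)
    (form (x + y) (b x) *: x) (form (x + y) (b y) *: y).
Proof.
move=> scX Sx Sy xy0.
have fx : form x (x + y) = form x y by rewrite skewDr skewvv add0r.
have fy : form y (x + y) = - form x y by rewrite skewDr skewvv addr0 skewC.
have nbxy := norm_birkhoff_normal_eq Sx Sy xy0.
have nb0 : 0 < `|b x| by rewrite normr_gt0 birkhoff_normal_neq0.
split.
- by rewrite mulr_gt0 // normr_gt0.
- move=> w; rewrite /circle /= => wc.
  have bound v : unit_circle v -> `|b v| = `|b x| ->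
      `|form v (w - (x + y))| <= `|form x y|.
    move=> Sv nbv; have [vb f1] := birkhoff_normalP Sv.
    have bv := radonX vb.
    have f0 : form (b v) v != 0 by rewrite skewC f1 oppr_eq0 oner_eq0.
    have := birkhoff_form_le dimX (w - (x + y)) f0 bv.
    by rewrite wc skewC normrN [form (b v) v]skewC f1 normrN1 mul1r nbv
      ler_pM2r.
  have Bx := bound x Sx erefl; have By := bound y Sy (esym nbxy).
  have wE := form_decomp dimX w xy0.
  exists (form w y / form x y), (form x w / form x y).
  have key (e : R) : `|e| <= `|form x y| -> 0 <= (form x y + e) / form x y.
    move=> le; rewrite mulrDl divff // -lerBlDl sub0r.
    suff : `|e / form x y| <= 1 by rewrite ler_norml => /andP[].
    by rewrite normrM normfV ler_pdivrMr ?mul1r // normr_gt0.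
  split=> //.
  + have -> : form w y = form x y + - form y (w - (x + y)).
      by rewrite skewDr skewNr fy [form w y]skewC; ring.
    by apply: key; rewrite normrN.
  + have -> : form x w = form x y + form x (w - (x + y)).
      by rewrite skewDr skewNr fx; ring.
    exact: key.
- by have := foot_supporting (x + y) Sx; rewrite fx.
- by have := foot_supporting (x + y) Sy; rewrite fy normrN nbxy.
Qed.

End RadonPlane.

Theorem theorem3p2p1 (R : realType) (X : normedVectType R)
    (dimX : \dim {: X} = 2%N)
    (smoothX : smooth X) (scX : strictly_convex X) (radonX : radon X)
    (form : {skew_symmetric X}) (sympl : is_psymplectic form)
    (x y : X) (Sx : unit_circle x) (Sy : unit_circle y)
    (freexy : free [:: x; y]) :
  outer_distortion x y = cm form x (x + y) / cm form y (x + y).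
Proof.
have xy0 := free_form_neq0 dimX sympl freexy.
have yx0 : form y x != 0 by rewrite skewC oppr_eq0.
have nxy0 : `|x + y| != 0.
  rewrite normr_eq0; apply: contra xy0 => /eqP s0.
  have := skewDr form x y x; rewrite s0 skewvv add0r => <-.
  by rewrite -(scale0r x) skewZr mul0r.
have px := form_add_birkhoff_normal_gt0 dimX sympl smoothX radonX scX Sx Sy xy0.
have py := form_add_birkhoff_normal_gt0 dimX sympl smoothX radonX scX Sy Sx yx0.
rewrite [y + x]addrC in py.
rewrite /outer_distortion /cm; set P := (P in get P).
(* The circle centered at [x + y] shows that the set is nonempty. The value of [get] then comes from
   some inscribed circle, and its scale [s] cancels in the ratio. *)
have [|c [r [alpha [beta [a0 b0 ins ->]]]]] := @getPex R P.
  exists (form (x + y) (birkhoff_normal form x) /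
    form (x + y) (birkhoff_normal form y)).
  exists (x + y), (`|form x y| * `|birkhoff_normal form x|),
    (form (x + y) (birkhoff_normal form y)),
    (form (x + y) (birkhoff_normal form x)).
  split=> //; first exact: inscribed_add.
  by rewrite !normrZ Sx Sy !mulr1 !gtr0_norm.
have [s s0 [betaE alphaE]] :=
  inscribed_center dimX sympl smoothX radonX Sx Sy xy0 ins.
rewrite !normrZ Sx Sy !mulr1 !gtr0_norm // betaE alphaE.
by field; rewrite s0 nxy0 lt0r_neq0.
Qed.
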